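(* Let $p$ be a prime and let $A\subset\mathbb{Z}/p^2\mathbb{Z}$ be a set of coset representatives for the subgroup $p(\mathbb{Z}/p^2\mathbb{Z})$ in $\mathbb{Z}/p^2\mathbb{Z}$. For $a,b\in A$, let $a'$ be the unique element of $A$ with $a'\equiv a+b \pmod p$, and call $a+b-a'\in p(\mathbb{Z}/p^2\mathbb{Z})$ the carry of $(a,b)$; the carries matrix of $A$ is the matrix of these carries indexed by $(a,b)\in A\times A$. Suppose the carries matrix of $A$ contains only two distinct entries. Then there exist $c\in(\mathbb{Z}/p^2\mathbb{Z})^{\times}$ and $d\in p(\mathbb{Z}/p^2\mathbb{Z})$ such that either $cA+d=\{0,1,\dots,p-1\}$ or $cA+d=\{1,2,\dots,p\}$.
   Context: $cA+d=\{ca+d : a\in A\}$, computed in $\mathbb{Z}/p^2\mathbb{Z}$. *)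

(* Defs.v *)
From mathcomp Require Import all_boot all_order all_algebra.

Set Implicit Arguments.
Unset Strict Implicit.
Unset Printing Implicit Defensive.

Import GRing.Theory.
Local Open Scope ring_scope.

(* ['Z_n] is Z/nZ only for [1 < n]; this holds for [n = p ^ 2] with p prime. *)
Notation Zp2 p := ('Z_(p ^ 2)%N).

Definition pZ (p : nat) : {set Zp2 p} := [set p%:R * x | x : Zp2 p].

Definition eqmodp (p : nat) (x y : Zp2 p) : bool := x - y \in pZ p.

Definition coset_representatives (p : nat) (A : {set Zp2 p}) : Prop :=
  forall x : Zp2 p, exists! a : Zp2 p, a \in A /\ eqmodp a x.

(* The default value 0 is never used when A is a set of coset representatives. *)
Definition representative (p : nat) (A : {set Zp2 p}) (x : Zp2 p) : Zp2 p :=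
  odflt 0 [pick a in A | eqmodp a x].

Definition carry (p : nat) (A : {set Zp2 p}) (a b : Zp2 p) : Zp2 p :=
  a + b - representative A (a + b).

Definition carries_matrix (p : nat) (A : {set Zp2 p}) : 'M[Zp2 p]_#|A| :=
  \matrix_(i, j) carry A (enum_val i) (enum_val j).

Definition entries (T : finType) (m n : nat) (M : 'M[T]_(m, n)) : {set T} :=
  [set M i j | i : 'I_m, j : 'I_n].

Definition affine_image (p : nat) (c d : Zp2 p) (A : {set Zp2 p}) :
    {set Zp2 p} :=
  [set c * a + d | a in A].

(* Main.v *)
Require Import Defs.
From mathcomp Require Import all_boot all_order all_algebra.
From mathcomp Require Import zify ring.

Set Implicit Arguments.
Unset Strict Implicit.
Unset Printing Implicit Defensive.

Import GRing.Theory.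
Local Open Scope ring_scope.

(** An affine change of variable makes all carries equal to [0] or [p] and
    puts [0] in [A].  Let [s k] be the representative of [k] and [b = s 1].
    The carries of [(b, s k)], [k < p], telescope to [p b = p], so exactly one
    of them is nonzero.  If it occurred before [k = p - 1], at [k = m - 1] say,
    then [s (p - 1) = - b] and [s m = m b - p], and the carry of this pair would
    be [- p].  Hence [s k = k b] for all [k < p], and [A] is a multiple of
    [{0, ..., p - 1}]. *)

Section ModPrimeSquare.

Variable p : nat.
Hypothesis p_pr : prime p.

Local Notation P := (p%:R : Zp2 p).

Lemma sqr_prime_gt1 : (1 < p ^ 2)%N.
Proof. by rewrite -(exp1n 2) ltn_exp2r // prime_gt1. Qed.

Lemma natr_Zp2_eq0 n : ((n%:R : Zp2 p) == 0) = (p ^ 2 %| n)%N.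
Proof. by rewrite -val_eqE /= val_Zp_nat ?sqr_prime_gt1. Qed.

Lemma natr_p_sqr : P * P = 0.
Proof. by apply/eqP; rewrite -natrM natr_Zp2_eq0 mulnn. Qed.

Lemma natr_p_muln_eq0 n : (P *+ n == 0) = (p %| n)%N.
Proof. by rewrite -mulrnA natr_Zp2_eq0 -mulnn dvdn_pmul2l // prime_gt0. Qed.

Lemma pZP (x : Zp2 p) : reflect (exists t, x = P * t) (x \in pZ p).
Proof.
apply: (iffP imsetP) => [[t _ ->] | [t ->]]; first by exists t.
by exists t.
Qed.

Lemma eqmodp_sym (x y : Zp2 p) : eqmodp x y -> eqmodp y x.
Proof.
by move=> /pZP[t e]; apply/pZP; exists (- t); rewrite mulrN -e opprB.
Qed.

Lemma eqmodp_trans (y x z : Zp2 p) : eqmodp x y -> eqmodp y z -> eqmodp x z.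
Proof.
move=> /pZP[t e] /pZP[t' e']; apply/pZP; exists (t + t').
by rewrite mulrDr -e -e' addrA subrK.
Qed.

Lemma eqmodpD (x x' y y' : Zp2 p) :
  eqmodp x x' -> eqmodp y y' -> eqmodp (x + y) (x' + y').
Proof.
move=> /pZP[t e] /pZP[t' e']; apply/pZP; exists (t + t').
by rewrite mulrDr -e -e'; ring.
Qed.

Lemma eqmodp_mull (c x y : Zp2 p) : eqmodp x y -> eqmodp (c * x) (c * y).
Proof.
by move=> /pZP[t e]; apply/pZP; exists (c * t); rewrite -mulrBr e mulrCA.
Qed.

Lemma eqmodp_natr_modn n : eqmodp n%:R ((n %% p)%:R : Zp2 p).
Proof.
apply/pZP; exists (n %/ p)%:R.
by rewrite {1}(divn_eq n p) natrD addrK mulnC natrM.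
Qed.

(** Read as a natural number, [w] is not divisible by [p], hence it is coprime to [p ^ 2]. *)
Lemma natr_p_mul_neq0_unit (w : Zp2 p) : P * w != 0 -> w \is a GRing.unit.
Proof.
rewrite -(natr_Zp w) unitZpE ?sqr_prime_gt1 // mulr_natr natr_p_muln_eq0 => ndv.
by rewrite coprimeXl // prime_coprime.
Qed.

(** Natural indices with period [p], in place of residue classes, let the carries of [(s 1, s j)] be
    summed by induction on [j]. *)
Lemma carries_progression (s : nat -> Zp2 p) :
  s 0 = 0 -> (forall j, s (j + p)%N = s j) -> P * s 1 = P ->
  (forall i j, s i + s j - s (i + j)%N \in [set 0; P]) ->
  forall j, (j < p)%N -> s j = s 1 *+ j.
Proof.
move=> s0 sD Ps1 carryP.
(* [N j] counts the nonzero carries of the pairs [(s 1, s i)] with [i < j]; each of these carries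
   equals [P]. *)
pose N j := (\sum_(i < j) (s 1 + s i != s i.+1)%R)%N.
have NS j : N j.+1 = (N j + (s 1 + s j != s j.+1)%R)%N by rewrite /N big_ord_recr.
have sN j : s j + P *+ N j = s 1 *+ j.
  elim: j => [|j IH]; first by rewrite /N big_ord0 s0 addr0.
  rewrite NS mulrS -IH.
  have := carryP 1 j; rewrite add1n !inE subr_eq0.
  have [<- _|_ /= /eqP <-] := eqVneq; first by rewrite addn0 addrA.
  by rewrite mulrnDr mulr1n; ring.
have N_le i j : (i <= j)%N -> (N i <= N j)%N.
  by move=> /subnKC <-; elim: (j - i)%N => [|k IH]; rewrite ?addn0 // addnS NS; lia.
have N_ub j : (N j <= j)%N.
  by elim: j => [|j IH]; [rewrite /N big_ord0 | rewrite NS; lia].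
have p_gt1 := prime_gt1 p_pr.
(* At [j = p] the telescoped sum reads [P *+ N p = P], so [N p] is 1 modulo [p], and [N p <= p]
   leaves only 1. *)
have Np : N p = 1%N.
  have sp : s p = 0 by have := sD 0%N; rewrite s0.
  have := sN p; rewrite sp add0r -(mulr_natl (s 1)) Ps1 => e.
  have Np_gt0 : (0 < N p)%N.
    rewrite lt0n; apply/eqP => N0; move/eqP: e.
    by rewrite N0 mulr0n eq_sym -[P]mulr1n natr_p_muln_eq0 dvdn1; lia.
  have : (p %| (N p).-1)%N.
    rewrite -natr_p_muln_eq0 -(inj_eq (addrI P)) addr0 -mulrS prednK //.
    by apply/eqP.
  have := N_ub p; case: (posnP (N p).-1) => [|h1 h2 /dvdn_leq]; lia.
have Npred : N p.-1 = 0%N.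
  apply/eqP; rewrite -leqn0 leqNgt; apply/negP => Npos.
  have exN : exists j, (0 < N j)%N by exists p.-1.
  case: (ex_minnP exN) => m Nm_gt0 m_min.
  have m_le := m_min _ Npos.
  have N1 : N 1 = 0%N by rewrite /N big_ord1 s0 addr0 eqxx.
  (* With [m <= p - 1] this forces [p > 2], which excludes [- P = P] at the end. *)
  have m_gt1 : (1 < m)%N.
    case: m Nm_gt0 {m_min m_le} => [|[|//]]; last by rewrite N1.
    by rewrite /N big_ord0.
  have Nm : N m = 1%N by have : (N m <= N p)%N by [apply: N_le; lia]; lia.
  have Np1 : N p.-1 = 1%N by have : (N p.-1 <= N p)%N by [apply: N_le; lia]; lia.
  have Nm1 : N m.-1 = 0%N.
    by apply/eqP; rewrite -leqn0 leqNgt; apply/negP => /m_min; lia.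
  (* Modulo [p] the indices add up to [m - 1]. Both [s m] and [s p.-1] contain one correction [- P],
     while [s m.-1] contains none. *)
  have := carryP m p.-1; have -> : (m + p.-1 = m.-1 + p)%N by lia.
  rewrite sD.
  have -> : s m + s p.-1 - s m.-1 = - P.
    have := sN m.-1; rewrite Nm1 mulr0n addr0 => ->.
    have -> : s m = s 1 *+ m - P by rewrite -sN Nm mulr1n addrK.
    have -> : s p.-1 = s 1 *+ p.-1 - P by rewrite -sN Np1 mulr1n addrK.
    have em : s 1 *+ m = s 1 *+ m.-1 + s 1 by rewrite -mulrSr prednK //; lia.
    have ep : s 1 *+ p.-1 = P - s 1.
      apply/eqP; rewrite eq_sym subr_eq -mulrSr prednK ?prime_gt0 //.
      by rewrite -(mulr_natl (s 1)) Ps1.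
    by rewrite em ep; ring.
  rewrite !inE oppr_eq0 -[P]mulr1n natr_p_muln_eq0 mulr1n eq_sym -addr_eq0.
  rewrite -mulr2n natr_p_muln_eq0 => /orP[] /dvdn_leq; lia.
move=> j j_lt; rewrite -sN.
have -> : N j = 0%N by have : (N j <= N p.-1)%N by [apply: N_le; lia]; lia.
by rewrite addr0.
Qed.

Section Representatives.

Variable A : {set Zp2 p}.
Hypothesis hA : coset_representatives A.

Local Notation r := (representative A).

Lemma representativeP x : r x \in A /\ eqmodp (r x) x.
Proof.
rewrite /representative; case: pickP => [a /andP[] // | none].
by have [a [[aA ax] _]] := hA x; move: (none a); rewrite aA ax.
Qed.

Lemma representative_uniq a x : a \in A -> eqmodp a x -> r x = a.
Proof.
move=> aA ax; have [b [_ bU]] := hA x.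
by rewrite -(bU a) // -(bU (r x)) //; apply: representativeP.
Qed.

Lemma eq_representative x y : eqmodp x y -> r x = r y.
Proof.
move=> xy; have [ryA ry] := representativeP y.
by apply: representative_uniq => //; apply: eqmodp_trans ry (eqmodp_sym xy).
Qed.

Lemma carry_entries a b :
  a \in A -> b \in A -> carry A a b \in entries (carries_matrix A).
Proof.
move=> aA bA; apply/imset2P.
exists (enum_rank_in aA a) (enum_rank_in aA b) => //.
by rewrite mxE !enum_rankK_in.
Qed.

Lemma entries_pZ x : x \in entries (carries_matrix A) -> x \in pZ p.
Proof.
case/imset2P => i j _ _ ->; rewrite mxE.
by have [_ /eqmodp_sym] := representativeP (enum_val i + enum_val j).
Qed.

(** The class of 0 is closed under addition, so the carry of [(r 0, r 0)] is [r 0 + r 0 - r 0]. *)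
Lemma representative0_entry : r 0 \in entries (carries_matrix A).
Proof.
have [r0A r0] := representativeP 0.
suff <- : carry A (r 0) (r 0) = r 0 by apply: carry_entries.
rewrite /carry -[X in _ - X](@eq_representative 0) ?addrK //.
by apply: eqmodp_sym; rewrite -[0 in X in eqmodp _ X]addr0; apply: eqmodpD.
Qed.

(** Subtracting [u = r 0] from [A] puts 0 in the set and lowers every carry by [u]. Dividing by [w],
    where [v - u = P * w], then turns the two carries into 0 and [P], as [carries_progression]
    requires. *)
Lemma two_carries_affine_interval u v :
  u != v -> entries (carries_matrix A) = [set u; v] -> r 0 = u ->
  exists c d : Zp2 p,
    [/\ c \is a GRing.unit, d \in pZ p &
        affine_image c d A = [set (k : nat)%:R | k : 'I_p]].
Proof.
move=> uv eE r0.
have up : u \in pZ p by apply: entries_pZ; rewrite eE !inE eqxx.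
have vp : v \in pZ p by apply: entries_pZ; rewrite eE !inE eqxx orbT.
have [w vuw] : exists w, v - u = P * w.
  have [/pZP[t ->] /pZP[t' ->]] := (up, vp).
  by exists (t' - t); rewrite mulrBr.
have w_unit : w \is a GRing.unit.
  by apply: natr_p_mul_neq0_unit; rewrite -vuw subr_eq0 eq_sym.
(* [s k] is the element of [w^-1 * (A - u)] in the class of [k]: [u] vanishes modulo [p], and
   division by [w] sends the class of [w * k] to that of [k]. *)
pose s k := w^-1 * (r (w * k%:R) - u).
have s0 : s 0%N = 0 by rewrite /s mulr0 r0 subrr mulr0.
have sD j : s (j + p)%N = s j.
  rewrite /s (@eq_representative _ (w * j%:R)) //; apply: eqmodp_mull.
  by apply/pZP; exists 1; rewrite natrD mulr1; ring.
have [t s1] : exists t, s 1%N = 1 + P * t.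
  have [_ /pZP[t e]] := representativeP (w * 1%:R); have /pZP[t' e'] := up.
  exists (w^-1 * (t - t')); rewrite /s e'.
  have -> : r (w * 1%:R) = w + P * t by rewrite -e mulr1 addrC subrK.
  rewrite -(mulVr w_unit); ring.
have Ps1 : P * s 1%N = P by rewrite s1 mulrDr mulrA natr_p_sqr; ring.
have s1_unit : s 1%N \is a GRing.unit.
  (* The inverse of [1 + P * t] is [1 - P * t] because [P * P = 0]. *)
  apply/unitrPr; exists (1 - P * t); rewrite s1.
  have -> : (1 + P * t) * (1 - P * t) = 1 - (P * P) * (t * t) by ring.
  by rewrite natr_p_sqr mul0r subr0.
have carryP i j : s i + s j - s (i + j)%N \in [set 0; P].
  have [riA ri] := representativeP (w * i%:R).
  have [rjA rj] := representativeP (w * j%:R).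
  have := carry_entries riA rjA; rewrite eE /carry.
  rewrite (@eq_representative (_ + _) (w * (i + j)%:R)); last first.
    by rewrite natrD mulrDr; apply: eqmodpD.
  set x := r _; set y := r _; set z := r _.
  have -> : s i + s j - s (i + j)%N = w^-1 * (x + y - z - u).
    by rewrite /s -/x -/y -/z; ring.
  rewrite !inE => /orP[] /eqP ->; first by rewrite subrr mulr0 eqxx.
  by rewrite vuw mulrCA mulVr // mulr1 eqxx orbT.
have sP := carries_progression s0 sD Ps1 carryP.
(* This is the map [a -> (s 1)^-1 * (w^-1 * (a - u))]; it sends [r (w * k)] to [k] for [k < p],
   since [s k = s 1 *+ k]. *)
exists ((s 1%N)^-1 * w^-1), (- ((s 1%N)^-1 * w^-1 * u)); split.
- by rewrite unitrM !unitrV s1_unit.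
- have /pZP[t' ->] := up; apply/pZP; exists (- ((s 1%N)^-1 * w^-1 * t')); ring.
have key k : (k < p)%N ->
    (s 1%N)^-1 * w^-1 * r (w * k%:R) - (s 1%N)^-1 * w^-1 * u = k%:R.
  move=> k_lt; rewrite -mulrBr -mulrA -/(s k) (sP k) // -(mulr_natr (s 1%N)) mulrA.
  by rewrite mulVr // mul1r.
apply/setP => x; apply/imsetP/imsetP => [[a aA ->] | [k _ ->]].
(* The index of [a] is the residue of [w^-1 * a] modulo [p]. *)
- have lt_p : ((w^-1 * a)%R %% p < p)%N by rewrite ltn_pmod ?prime_gt0.
  exists (Ordinal lt_p) => //; rewrite -[RHS]key //; congr (_ * _ - _).
  apply/esym/representative_uniq => //.
  rewrite -{1}[a](mulVKr w_unit); apply: eqmodp_mull.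
  by rewrite -{1}(natr_Zp (w^-1 * a)); apply: eqmodp_natr_modn.
- exists (r (w * k%:R)); first by case: (representativeP (w * k%:R)).
  by rewrite key.
Qed.

End Representatives.

End ModPrimeSquare.

Theorem theorem6p1 (p : nat) (A : {set Zp2 p})
    (hp : prime p)
    (hA : coset_representatives A)
    (hcarries : #|entries (carries_matrix A)| = 2%N) :
  exists c d : Zp2 p,
    [/\ c \is a GRing.unit, d \in pZ p &
        affine_image c d A = [set (k : nat)%:R | k : 'I_p]
        \/ affine_image c d A = [set (k.+1)%:R | k : 'I_p]].
Proof.
have /cards2P[u [v [uv eE]]] : #|entries (carries_matrix A)| == 2%N by apply/eqP.
have [c [d [cU dp e]]] : exists c d : Zp2 p,
    [/\ c \is a GRing.unit, d \in pZ p &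
        affine_image c d A = [set (k : nat)%:R | k : 'I_p]].
  (* One of the two carries is [r 0]; it takes the role of [u], after an exchange if it is [v]. *)
  have := representative0_entry hA; rewrite eE !inE => /orP[] /eqP r0.
    exact: two_carries_affine_interval uv eE r0.
  rewrite eq_sym in uv; rewrite setUC in eE.
  exact: two_carries_affine_interval uv eE r0.
by exists c, d; split=> //; left.
Qed.
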